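(* Let $a(\cdot),b(\cdot):[0,\infty)\to\mathbb{R}$ be Lebesgue measurable and essentially bounded functions with $a(t)\ge\alpha>0$ for some constant $\alpha$ and $b(t)\ge 0$. Suppose there exist numbers $a>0$, $b>0$ such that at least one of the following conditions holds: 1) $a^2>4b$ and $\displaystyle \|a(\cdot)-a\|\,\frac{2a}{\sqrt{a^2-4b}\,(a-\sqrt{a^2-4b})}+\|b(\cdot)-b\|\,\frac1b<1$; 2) $a^2<4b$ and $\displaystyle \|a(\cdot)-a\|\,\frac{2(a+\sqrt{4b-a^2})}{a\sqrt{4b-a^2}}+\|b(\cdot)-b\|\,\frac{4}{a\sqrt{4b-a^2}}<1$; 3) $a^2=4b$ and $\displaystyle \|a(\cdot)-a\|\,\frac{2}{\sqrt b}+\|b(\cdot)-b\|\,\frac1b<1$, where $\|\cdot\|$ is the norm in $L_\infty[t_0,\infty)$ for some $t_0\ge 0$. Then the equation $\ddot x(t)+a(t)\dot x(t)+b(t)x(t)=0$ is exponentially stable.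
   Context: Inequalities between coefficients are understood almost everywhere. The fundamental function $X(t,s)$: for each fixed $s\ge 0$, $X(\cdot,s)$ is the solution (with locally absolutely continuous derivative, equation satisfied almost everywhere) of $\ddot x(t)+a(t)\dot x(t)+b(t)x(t)=0$ on $t\ge s$ with $x(s)=0$, $\dot x(s)=1$. The equation is called exponentially stable if there exist $K>0,\lambda>0$ such that $|X(t,s)|\le K e^{-\lambda(t-s)}$ for all $t\ge s\ge 0$. *)

(* Defs.v *)
From HB Require Import structures.
From mathcomp Require Import all_boot all_order all_algebra.
From mathcomp Require Import all_classical all_reals all_analysis.

Set Implicit Arguments.
Unset Strict Implicit.
Unset Printing Implicit Defensive.

Import Order.TTheory GRing.Theory Num.Theory.
Import numFieldNormedType.Exports.

Local Open Scope classical_set_scope.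
Local Open Scope ring_scope.

(* MathComp-Analysis, over an arbitrary R : realType.  Functions on a half-line
   are total functions R -> R of which only the values there are used. *)

(* The domain carries the complete sigma-algebra of Lebesgue measurable sets
   (that of completed_lebesgue_measure), the codomain the Borel one. *)
Definition lebesgue_measurable_fun (R : realType) (D : set R) (f : R -> R) :
    Prop :=
  @measurable_fun _ _ (caratheodory_type ((@wlength R idfun)^*)%mu)
    (measurableTypeR R) D f.

(* Almost-everywhere statements only need a set contained in a Borel null set,
   hence refer to Lebesgue null sets although lebesgue_measure is Borel. *)
Definition ess_bounded (R : realType) (D : set R) (f : R -> R) : Prop :=
  exists M : R, {ae lebesgue_measure, forall t : R, D t -> `|f t| <= M}.

Definition Linfty_norm (R : realType) (t0 : R) (f : R -> R) : \bar R :=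
  Lnorm (mrestr (@lebesgue_measure R)
           (measurable_itv (Interval (BLeft t0) (BInfty R false))))
    +oo%E (EFin \o f).

Definition abs_continuous (R : realType) (c d : R) (f : R -> R) : Prop :=
  forall e : R, 0 < e -> exists2 delta : R, 0 < delta &
    forall (n : nat) (u v : 'I_n -> R),
      (forall i, c <= u i /\ u i <= v i /\ v i <= d) ->
      trivIset [set: 'I_n] (fun i => [set` `]u i, v i[]) ->
      \sum_(i < n) (v i - u i) < delta ->
      \sum_(i < n) `|f (v i) - f (u i)| < e.

Definition locally_abs_continuous (R : realType) (D : set R) (f : R -> R) :
    Prop :=
  forall c d : R, [set` `[c, d]] `<=` D -> abs_continuous c d f.

(* v is the derivative of x on [s, +oo[, one-sided at the end point s. *)
Definition derivative_on_halfline (R : realType) (s : R) (x v : R -> R) :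
    Prop :=
  (forall t : R, s < t -> is_derive t 1 x (v t)) /\
  (fun h : R => h^-1 * (x (s + h) - x s)) @ 0^'+ --> v s.

(* x solves x'' + a x' + b x = 0 on [s, +oo[ with x' = v. *)
Definition is_solution (R : realType) (a b : R -> R) (s : R) (x v : R -> R) :
    Prop :=
  [/\ derivative_on_halfline s x v,
      locally_abs_continuous [set` `[s, +oo[] v &
      {ae lebesgue_measure, forall t : R, s <= t ->
        derivable v t 1 /\ derive1 v t + a t * v t + b t * x t = 0}].

Definition fundamental_function (R : realType) (a b : R -> R)
    (X : R -> R -> R) : Prop :=
  forall s : R, 0 <= s ->
    exists v : R -> R,
      [/\ is_solution a b s (fun t => X t s) v, X s s = 0 & v s = 1].

(* For locally essentially bounded measurable a and b, the fundamental function
   exists and its values X t s with 0 <= s <= t are unique, so quantifying over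
   X only names it. *)
Definition exponentially_stable (R : realType) (a b : R -> R) : Prop :=
  forall X : R -> R -> R, fundamental_function a b X ->
    exists K lambda : R, [/\ 0 < K, 0 < lambda &
      forall t s : R, 0 <= s -> s <= t ->
        `|X t s| <= K * expR (- (lambda * (t - s)))].

(* Main.v *)
Require Import Defs.
From HB Require Import structures.
From mathcomp Require Import all_boot all_order all_algebra.
From mathcomp Require Import all_classical all_reals all_analysis.
From mathcomp Require Import measurable_realfun ess_sup_inf ring lra.
Import Order.TTheory GRing.Theory Num.Theory.
Import numFieldNormedType.Exports.
Local Open Scope classical_set_scope.
Local Open Scope ring_scope.

(** The equation is a perturbation of [x'' + a0 x' + b0 x = 0], whose
    fundamental solution [k] satisfies [\int |k| <= c0] and [\int |k'| <= c1],
    where [c0] and [c1] are the coefficients of the two norms in the hypothesis.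
    Variation of constants on [[t0, T]] bounds the maximum [M] of
    [A |x'| + B |x|], with [A] and [B] the norms of the perturbations, by
    [const + (A c1 + B c0) M], and [A c1 + B c0 < 1]. Since the inequality is
    strict, a small exponential weight can be inserted in all these estimates,
    which gives the decay. On [[s, t0]] the energy [x^2 + x'^2] grows at most
    exponentially. Integrals are avoided throughout: an absolutely continuous
    function whose derivative is a.e. nonpositive is nonincreasing, and integrals
    of majorants are replaced by explicit antiderivatives. *)

(** * Real induction and monotonicity from an almost everywhere sign of the derivative *)

(** Consider the supremum of the points of [[c, d]] where [P] holds. The step hypothesis straddles
    [x]: it carries [P] from just below the supremum up to it and beyond, which is absurd unless [d]
    is reached. *)
Lemma interval_induction (R : realType) (P : R -> Prop) (c d : R) :
  c <= d -> P c ->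
  (forall x, c <= x <= d -> exists2 r : R, 0 < r & forall s t, c <= s -> s <= x ->
     x <= t -> t <= d -> x - s < r -> t - x < r -> P s -> P t) ->
  P d.
Proof.
move=> cd Pc step.
pose S := [set s | c <= s <= d /\ P s].
have Sc : S c by split; rewrite ?lexx.
have ubS : ubound S d by move=> s [/andP[]].
have supS : has_sup S by split; [exists c | exists d].
have cx : c <= sup S by apply: ub_le_sup => //; case: supS.
have xd : sup S <= d by apply: ge_sup => //; exists c.
have [r r0 Hr] := step (sup S) ltac:(by rewrite cx xd).
have [s Ss sx] := sup_adherent r0 supS.
have [/andP[cs _] Ps] := Ss.
have sle : s <= sup S by apply: ub_le_sup => //; case: supS.
have [dr|rd] := leP d (sup S + r / 2).
  by apply: (Hr s d) => //; lra.
have Pt : P (sup S + r / 2) by apply: (Hr s) => //; lra.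
have : sup S + r / 2 <= sup S.
  apply: ub_le_sup; first by case: supS.
  by split => //; apply/andP; split; lra.
by move=> ?; exfalso; lra.
Qed.

Lemma is_derive_increment (R : realType) (f : R -> R) (x D e : R) :
  is_derive x 1 f D -> 0 < e ->
  exists2 r : R, 0 < r &
    forall y, `|y - x| < r -> `|f y - f x - D * (y - x)| <= e * `|y - x|.
Proof.
move=> [dfx <-] e0.
have /cvgrPdist_le/(_ _ e0)[r /= r0 Hr] := dfx.
exists r => // y yr.
have [->|yx] := eqVneq y x; first by rewrite !subrr mulr0 subrr normr0 mulr0.
have yx0 : y - x != 0 by rewrite subr_eq0.
have /= := Hr (y - x); rewrite sub0r normrN => /(_ yr yx0).
rewrite /GRing.scale/= mulr1 subrK => Hy.
rewrite -ler_pdivrMr ?normr_gt0// -normf_div -normrN.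
by apply: le_trans Hy; rewrite le_eqVlt; apply/orP; left; apply/eqP; congr (`| _ |);
  rewrite /derive/= /GRing.scale/=; field.
Qed.

Section AbsolutelyContinuousMonotone.
Context {R : realType}.
Notation mu := (@lebesgue_measure R).

(** Outer regularity applied to a Borel null set containing [N]; the excess measure of [U] is then
    all of its measure. *)
Lemma negligible_outer_open (N : set R) (e : R) : mu.-negligible N -> 0 < e ->
  exists U : set R, [/\ open U, N `<=` U & (mu U < e%:E)%E].
Proof.
move=> [A [mA A0 NA]] e0.
have Afin : (mu A < +oo)%E by have -> : mu A = 0%E by []; rewrite ltry.
have [U [oU AU Ue]] := lebesgue_regularity_outer mA Afin e0; exists U; split => //; first exact: subset_trans AU.
have mU : measurable U by exact: open_measurable.
rewrite -(setDUK AU) measureU//; last 2 first.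
- exact: measurableD.
- by rewrite setDIK.
by rewrite /= A0 add0e.
Qed.

(** Cover the exceptional null set by an open [U] of measure below the [delta] of absolute
    continuity. Real induction collects the stretches spent near points of [U] into finitely many
    disjoint intervals, on which [f] varies by less than [e / 2] in total. Elsewhere the derivative
    is nonpositive, and [f] grows with slope at most [e1]. *)
Lemma ac_nonincreasing (f : R -> R) (c d : R) : c <= d ->
  abs_continuous c d f ->
  {ae mu, forall t, c < t < d -> exists2 D : R, D <= 0 & is_derive t 1 f D} ->
  f d <= f c.
Proof.
move=> cd acf aef; apply/ler_addgt0Pr => e e0.
have e20 : 0 < e / 2 by lra.
have [delta delta0 Hdelta] := acf _ e20.
(* This makes [e1 * (d - c) <= e / 2]; the [+ 1] covers [c = d]. *)
pose e1 := e / 2 / (d - c + 1).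
have e10 : 0 < e1 by rewrite /e1 divr_gt0//; lra.
have negc x : mu.-negligible [set x].
  by exists [set x]; split => //; exact: lebesgue_measure_set1.
(* The end points join the exceptional set, because the derivative is controlled only in the open
   interval. *)
have [U [oU NU Udelta]] := negligible_outer_open
  _ _ (negligibleU (negligibleU aef (negc c)) (negc d)) delta0.
have mU : measurable U by exact: open_measurable.
(* The invariant at [s]: ordered intervals inside [[c, s]], of total length at most the part of [U]
   swept so far, which account for all growth of [f] beyond slope [e1]. *)
pose P s := exists n (u v : nat -> R),
  [/\ forall i, (i < n)%N -> [/\ c <= u i, u i <= v i & v i <= s],
      forall i j, (i < j < n)%N -> v i <= u j,
      ((\sum_(i < n) (v i - u i))%:E <= mu (U `&` `]c, s]))%E &
      f s - f c <= e1 * (s - c) + \sum_(i < n) `|f (v i) - f (u i)|].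
have Pd : P d.
  apply: (@interval_induction _ P c d) => //.
    exists 0%N, (fun=> c), (fun=> c); split => //.
    - by rewrite big_ord0.
    - by rewrite big_ord0 !subrr mulr0 addr0.
  move=> x /andP[cx xd].
  (* Near a point of [U] the whole of []s, t]] lies in [U], so [[s, t]] is appended and both sides
     of the length estimate grow by [t - s]. *)
  have [Ux|nUx] := pselect (U x).
    have [r /= r0 Hr] := oU x Ux; exists r => //.
    move=> s t cs sx xt td sr tr [n [u [v [H1 H2 H3 H4]]]].
    have sub : `]s, t] `<=` U.
      move=> y /=; rewrite in_itv/= => /andP[sy yt]; apply: Hr => /=.
      by rewrite ltr_norml; apply/andP; split; lra.
    exists n.+1, (fun i => if (i < n)%N then u i else s),
      (fun i => if (i < n)%N then v i else t).
    have eqs (F : R -> R -> R) : \sum_(i < n.+1)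
        F (if (i < n)%N then v i else t) (if (i < n)%N then u i else s) =
        \sum_(i < n) F (v i) (u i) + F t s.
      rewrite big_ord_recr/= ltnn; congr (_ + _).
      by apply: eq_bigr => i _; rewrite ltn_ord.
    split.
    - move=> i _; case: ifPn => ni; last by split => //; lra.
      by have [? ? ?] := H1 i ni; split => //; lra.
    - move=> i j /andP[ij jn].
      have ni : (i < n)%N by apply: leq_trans ij _.
      rewrite ni; case: ifPn => nj; first by apply: H2; rewrite ij.
      by have [] := H1 i ni.
    - rewrite (eqs (fun x y => x - y)).
      have -> : U `&` `]c, t] = (U `&` `]c, s]) `|` `]s, t].
        apply/seteqP; split => y /=; rewrite !in_itv/=.
          move=> [Uy /andP[cy yt]]; have [ys|sy] := leP y s; first by left; rewrite cy.
          by right; rewrite yt.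
        move=> [[Uy /andP[cy ys]]|/andP[sy yt]].
          by split => //; rewrite cy/=; lra.
        by split; [apply: sub; rewrite /= in_itv/= sy|apply/andP; split; lra].
      rewrite [leRHS]measureU//; last 2 first.
      + exact: measurableI.
      + apply/seteqP; split => y //=; rewrite !in_itv/= => -[[_ /andP[_ ys]] /andP[sy _]].
        by exfalso; lra.
      rewrite EFinD; apply: leeD => //.
      have := lebesgue_measure_itv `]s, t]; rewrite /= lte_fin => ->.
      by case: ifPn; rewrite -?EFinD ?lee_fin -?leNgt; lra.
    - rewrite (eqs (fun x y => `|f x - f y|)).
      have : f t - f s <= `|f t - f s| by exact: ler_norm.
      have : e1 * (s - c) <= e1 * (t - c) by rewrite ler_pM2l//; lra.
      lra.
  (* Outside [U] the family is kept: the increments from [s] to [x] and from [x] to [t] are at most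
     [e1] times their lengths. *)
  have [D D0 dfx] : exists2 D : R, D <= 0 & is_derive x 1 f D.
    apply: contrapT => nD; apply: nUx; apply: NU.
    have [->|xc] := eqVneq x c; first by left; right.
    have [->|xd'] := eqVneq x d; first by right.
    left; left => /= H; apply: nD; apply: H.
    by rewrite !lt_neqAle cx xd eq_sym xc xd'.
  have [r r0 Hr] := is_derive_increment _ _ _ _ _ dfx e10.
  exists r => // s t cs sx xt td sr tr [n [u [v [H1 H2 H3 H4]]]].
  exists n, u, v; split => //.
  - by move=> i /H1[? ? ?]; split => //; lra.
  - apply: le_trans H3 _; apply: le_measure; rewrite ?inE; try exact: measurableI.
    move=> y [Uy /=]; rewrite !in_itv/= => /andP[-> ys]; split => //=; lra.
  - have := Hr t; rewrite ger0_norm; last by lra.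
    move=> /(_ tr); rewrite ler_norml => /andP[_ ht].
    have := Hr s; rewrite ler0_norm; last by lra.
    rewrite opprB => /(_ sr); rewrite ler_norml => /andP[hs _].
    have : D * (t - x) <= 0 by rewrite mulr_le0_ge0//; lra.
    have : 0 <= D * (s - x) by rewrite mulr_le0//; lra.
    lra.
have [n [u [v [H1 H2 H3 H4]]]] := Pd.
have : \sum_(i < n) `|f (v i) - f (u i)| < e / 2.
  apply: (Hdelta n (u \o val) (v \o val)).
  - by move=> i; have [] := H1 i (ltn_ord i).
  - apply/trivIsetP => i j _ _ ij.
    wlog lij : i j ij / (i < j)%N => [hw|].
      have := ij; rewrite neq_ltn => /orP[|ji]; first exact: hw.
      by rewrite setIC; apply: hw; rewrite // eq_sym.
    have := H2 i j; rewrite lij ltn_ord => /(_ isT) vu.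
    apply/seteqP; split => y //=; rewrite !in_itv/= => -[/andP[_ yv] /andP[uy _]].
    by exfalso; lra.
  - rewrite -lte_fin; apply: le_lt_trans H3 _; apply: le_lt_trans Udelta.
    by apply: le_measure; rewrite ?inE//; exact: measurableI.
have : e1 * (d - c) <= e / 2.
  rewrite /e1 -mulrA ler_piMr//; first by lra.
  by rewrite mulrC ler_pdivrMr; lra.
lra.
Qed.

End AbsolutelyContinuousMonotone.

#[local] Instance lebesgue_ae_filter (R : realType) :
  Filter (almost_everywhere (@lebesgue_measure R)) := ae_filter_ringOfSetsType _.

(** * Calculus of absolutely continuous functions *)

Section AbsoluteContinuity.
Context {R : realType}.
Implicit Types (f g : R -> R) (c d : R).

Lemma ac_lipschitz f c d (M : R) : 0 <= M ->
  (forall u v, c <= u -> u <= v -> v <= d -> `|f v - f u| <= M * (v - u)) ->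
  abs_continuous c d f.
Proof.
move=> M0 lipf e e0.
have M10 : 0 < M + 1 by lra.
exists (e / (M + 1)); first by rewrite divr_gt0.
move=> n u v uv _ sumlt.
apply: (@le_lt_trans _ _ ((M + 1) * \sum_(i < n) (v i - u i))).
  rewrite mulr_sumr; apply: ler_sum => i _; have [cu [uvi vd]] := uv i.
  apply: le_trans (lipf _ _ cu uvi vd) _; rewrite ler_wpM2r//; lra.
by rewrite mulrC -ltr_pdivlMr.
Qed.

Lemma acD f g c d : abs_continuous c d f -> abs_continuous c d g ->
  abs_continuous c d (fun t => f t + g t).
Proof.
move=> acf acg e e0; have e20 : 0 < e / 2 by lra.
have [d1 d10 H1] := acf _ e20; have [d2 d20 H2] := acg _ e20.
exists (Num.min d1 d2); first by rewrite lt_min d10.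
move=> n u v uv tI; rewrite lt_min => /andP[/(H1 n u v uv tI) h1 /(H2 n u v uv tI) h2].
apply: (@le_lt_trans _ _ (\sum_(i < n) `|f (v i) - f (u i)| +
                          \sum_(i < n) `|g (v i) - g (u i)|)); last by lra.
rewrite -big_split/=; apply: ler_sum => i _.
by rewrite opprD addrACA ler_normD.
Qed.

Lemma acN f c d : abs_continuous c d f -> abs_continuous c d (fun t => - f t).
Proof.
move=> acf e e0; have [d1 d10 H1] := acf _ e0; exists d1 => // n u v uv tI uvd.
have := H1 n u v uv tI uvd; congr (_ < _).
by apply: eq_bigr => i _; rewrite -opprD normrN.
Qed.

Lemma ac_uniform f c d (e : R) : abs_continuous c d f -> 0 < e ->
  exists2 r : R, 0 < r & forall u v, c <= u <= d -> c <= v <= d ->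
    `|u - v| < r -> `|f u - f v| < e.
Proof.
move=> acf e0; have [r r0 Hr] := acf _ e0; exists r => // u v.
wlog uv : u v / v <= u => [hw cud cvd|].
  have [vu|uv] := leP v u; first exact: hw.
  by rewrite distrC (distrC (f u)); apply: hw => //; exact: ltW.
move=> /andP[cu ud] /andP[cv vd]; rewrite ger0_norm ?subr_ge0// => uvr.
have := Hr 1%N (fun=> v) (fun=> u) (fun=> conj cv (conj uv ud)).
rewrite !big_ord1; apply => //.
by apply/trivIsetP => i j _ _; rewrite !ord1 eqxx.
Qed.

Lemma ac_within_continuous f c d : c < d -> abs_continuous c d f ->
  {within `[c, d], continuous f}.
Proof.
move=> cd acf; apply/continuous_within_itvP => //; split.
- move=> x; rewrite in_itv/= => /andP[cx xd].
  apply/cvgrPdist_lt => e e0; have [r r0 Hr] := ac_uniform _ _ _ _ acf e0.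
  near=> y; apply: Hr; first by rewrite !ltW.
    by apply/andP; split; apply/ltW; near: y; [exact: lt_nbhsr|exact: lt_nbhsl].
  by near: y; exists r.
- apply/cvgrPdist_lt => e e0; have [r r0 Hr] := ac_uniform _ _ _ _ acf e0.
  near=> y; apply: Hr; first by rewrite lexx ltW.
    apply/andP; split; [by near: y; exact: nbhs_right_ge|].
    by near: y; exact: nbhs_right_le.
  by near: y; exists r.
- apply/cvgrPdist_lt => e e0; have [r r0 Hr] := ac_uniform _ _ _ _ acf e0.
  near=> y; apply: Hr; first by rewrite lexx ltW.
    apply/andP; split; [by near: y; exact: nbhs_left_ge|].
    by near: y; exact: nbhs_left_le.
  by near: y; exists r.
Unshelve. all: by end_near. Qed.

Lemma within_continuous_bounded f c d : c <= d ->
  {within `[c, d], continuous f} ->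
  exists M : R, forall t, c <= t <= d -> `|f t| <= M.
Proof.
move=> cd cf; have [x _ fx] := EVT_max cd cf; have [y _ fy] := EVT_min cd cf.
exists (Num.max (f x) (- f y)) => t ctd.
have tin : t \in `[c, d] by rewrite in_itv.
have := fx t tin; have := fy t tin => h1 h2.
rewrite le_max; have [ft0|ft0] := leP 0 (f t).
  by rewrite ger0_norm// h2.
by rewrite ltr0_norm// lerN2 h1 orbT.
Qed.

(** The mean value theorem turns the bound on the derivative into a Lipschitz constant. *)
Lemma ac_derivable f f' c d (M : R) :
  {within `[c, d], continuous f} ->
  (forall t, c < t < d -> is_derive t 1 f (f' t)) ->
  (forall t, c <= t <= d -> `|f' t| <= M) ->
  abs_continuous c d f.
Proof.
move=> cf df bf'; apply: (@ac_lipschitz _ _ _ `|M|) => // u v cu uv vd.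
have [x] : exists2 x, x \in `[u, v]%R & f v - f u = f' x * (v - u).
  apply: MVT_segment => //.
    move=> x; rewrite in_itv/= => /andP[ux xv]; apply: df.
    by apply/andP; split; lra.
  apply: continuous_subspaceW cf => x /=; rewrite !in_itv/= => /andP[ux xv].
  by apply/andP; split; lra.
rewrite in_itv/= => /andP[ux xv] ->; rewrite normrM (ger0_norm (_ : 0 <= v - u)); last by lra.
rewrite ler_wpM2r ?subr_ge0//; apply: le_trans (ler_norm M).
by apply: bf'; apply/andP; split; lra.
Qed.

(** Both factors are bounded on [[c, d]] by a common [M], and an increment of the product splits
    into one increment of each factor times a bounded value. *)
Lemma acM f g c d : c < d -> abs_continuous c d f -> abs_continuous c d g ->
  abs_continuous c d (fun t => f t * g t).
Proof.
move=> cd acf acg e e0.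
have [Mf bf] := within_continuous_bounded _ _ _ (ltW cd) (ac_within_continuous _ _ _ cd acf).
have [Mg bg] := within_continuous_bounded _ _ _ (ltW cd) (ac_within_continuous _ _ _ cd acg).
pose M := Num.max 1 (Num.max Mf Mg).
have M1 : 1 <= M by rewrite /M le_max lexx.
have fM t : c <= t <= d -> `|f t| <= M.
  by move=> /bf h; rewrite /M !le_max h orbT.
have gM t : c <= t <= d -> `|g t| <= M.
  by move=> /bg h; rewrite /M !le_max h !orbT.
have e20 : 0 < e / 2 / M by rewrite !divr_gt0//; lra.
have [d1 d10 H1] := acf _ e20; have [d2 d20 H2] := acg _ e20.
exists (Num.min d1 d2); first by rewrite lt_min d10.
move=> n u v uv tI; rewrite lt_min => /andP[/(H1 n u v uv tI) h1 /(H2 n u v uv tI) h2].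
apply: (@le_lt_trans _ _ (M * \sum_(i < n) `|f (v i) - f (u i)| +
                          M * \sum_(i < n) `|g (v i) - g (u i)|)).
  rewrite !mulr_sumr -big_split/=; apply: ler_sum => i _.
  have [cu [uvi vd]] := uv i.
  have -> : f (v i) * g (v i) - f (u i) * g (u i) =
    (f (v i) - f (u i)) * g (v i) + f (u i) * (g (v i) - g (u i)) by ring.
  apply: le_trans (ler_normD _ _) _; rewrite !normrM.
  rewrite [`|_ - _| * `|g _|]mulrC; apply: lerD; apply: ler_wpM2r => //.
    by apply: gM; apply/andP; split; lra.
  by apply: fM; apply/andP; split; lra.
have : M * \sum_(i < n) `|f (v i) - f (u i)| < e / 2.
  by rewrite mulrC -ltr_pdivlMr//; lra.
have : M * \sum_(i < n) `|g (v i) - g (u i)| < e / 2.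
  by rewrite mulrC -ltr_pdivlMr//; lra.
by lra.
Qed.

Lemma is_derive_continuous f (f' : R -> R) :
  (forall t : R, is_derive t 1 f (f' t)) -> continuous f.
Proof.
by move=> df t; have [dft _] := df t; apply/differentiable_continuous/derivable1_diffP.
Qed.

Lemma ac_C1 f (f' : R -> R) c d : c <= d ->
  (forall t : R, is_derive t 1 f (f' t)) -> continuous f' -> abs_continuous c d f.
Proof.
move=> cd df cf'.
have [M fM] := within_continuous_bounded _ _ _ cd (continuous_subspaceT cf').
apply: (ac_derivable _ f' _ _ M) => //.
apply: continuous_subspaceT; exact: (is_derive_continuous _ _ df).
Qed.

(** Both [f - H] and [- f - H] have a.e. nonpositive derivatives, so [ac_nonincreasing] applies to
    each. This stands in for bounding the integral of [f'] by that of [h]. *)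
Lemma ac_increment_le f H (h : R -> R) c d : c <= d ->
  abs_continuous c d f -> abs_continuous c d H ->
  (forall t, c < t < d -> is_derive t 1 H (h t)) ->
  {ae (@lebesgue_measure R), forall t, c < t < d ->
    exists2 D : R, `|D| <= h t & is_derive t 1 f D} ->
  `|f d - f c| <= H d - H c.
Proof.
move=> cd acf acH dH aef; rewrite ler_norml; apply/andP; split.
- have := @ac_nonincreasing R (fun t => - f t - H t) c d cd.
  move=> /(_ (acD _ _ _ _ (acN _ _ _ acf) (acN _ _ _ acH))).
  suff P : {ae (@lebesgue_measure R), forall t, c < t < d ->
      exists2 D : R, D <= 0 & is_derive t 1 (fun t => - f t - H t) D}.
    by move=> /(_ P); lra.
  apply: filterS aef => t Ht ct; have [D Dh df] := Ht ct.
  exists (- D - h t); first by move: Dh; rewrite ler_norml => /andP[]; lra.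
  by have dHt := dH t ct; apply: is_deriveB.
- have := @ac_nonincreasing R (fun t => f t - H t) c d cd.
  move=> /(_ (acD _ _ _ _ acf (acN _ _ _ acH))).
  suff P : {ae (@lebesgue_measure R), forall t, c < t < d ->
      exists2 D : R, D <= 0 & is_derive t 1 (fun t => f t - H t) D}.
    by move=> /(_ P); lra.
  apply: filterS aef => t Ht ct; have [D Dh df] := Ht ct.
  exists (D - h t); first by move: Dh; rewrite ler_norml => /andP[]; lra.
  by have dHt := dH t ct; apply: is_deriveB.
Qed.

End AbsoluteContinuity.

(** * Derivative rules for explicitly written functions *)

Section PointwiseDerivatives.
Context {R : realType}.
Implicit Types (f g : R -> R) (x df dg : R).

Lemma is_deriveD_fun f g x df dg : is_derive x 1 f df -> is_derive x 1 g dg ->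
  is_derive x 1 (fun t => f t + g t) (df + dg).
Proof. by move=> ? ?; exact: is_deriveD. Qed.

Lemma is_deriveM_fun f g x df dg : is_derive x 1 f df -> is_derive x 1 g dg ->
  is_derive x 1 (fun t => f t * g t) (df * g x + f x * dg).
Proof.
move=> ? ?; apply: is_derive_eq (is_deriveM _ _) _.
by rewrite /GRing.scale/= addrC mulrC.
Qed.

Lemma is_deriveZ_fun (c : R) f x df : is_derive x 1 f df ->
  is_derive x 1 (fun t => c * f t) (c * df).
Proof. by move=> ?; exact: is_deriveZ. Qed.

Lemma is_derive_reflect f (T x df : R) : is_derive (T - x) 1 f df ->
  is_derive x 1 (fun t => f (T - t)) (- df).
Proof.
move=> ?; rewrite -mulrN1.
apply: (@is_derive1_comp R f (fun t => T - t)).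
have := is_deriveD_fun (cst T) -%R x 0 (-1) (is_derive_cst _ _ _) (is_deriveNid _ _).
by rewrite add0r.
Qed.

Lemma is_derive_expRZ (c x : R) :
  is_derive x 1 (fun t => expR (c * t)) (c * expR (c * x)).
Proof.
rewrite mulrC; apply: (@is_derive1_comp R expR (fun t => c * t)).
by have := @is_deriveZ_fun c id x 1 (is_derive_id _ _); rewrite mulr1.
Qed.

End PointwiseDerivatives.

Lemma ler_normM2 {R : realType} (p q P Q : R) :
  `|p| <= P -> `|q| <= Q -> `|p * q| <= P * Q.
Proof. by move=> pP qQ; rewrite normrM ler_pM. Qed.

(** * Solutions on compact intervals and variation of constants *)

Section SecondOrderEquation.
Context {R : realType}.
Implicit Types (a b x v : R -> R) (c d : R).
Notation mu := (@lebesgue_measure R).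

(** The form of [is_solution] on a compact interval to which the monotonicity argument applies: [x]
    and [v] both absolutely continuous, and the equation already solved for the derivative of
    [v]. *)
Definition solves_on a b c d x v : Prop :=
  [/\ abs_continuous c d x, abs_continuous c d v,
      forall t, c < t < d -> is_derive t 1 x (v t) &
      {ae mu, forall t, c < t < d ->
        is_derive t 1 v (- (a t * v t) - b t * x t)}].

Lemma abs_continuousW (f : R -> R) c d c' d' : c <= c' -> d' <= d ->
  abs_continuous c d f -> abs_continuous c' d' f.
Proof.
move=> cc dd acf e e0; have [r r0 Hr] := acf e e0; exists r => // n u v uv.
by apply: Hr => i; have [? [? ?]] := uv i; lra.
Qed.

Lemma solves_onW a b c d c' d' x v : c <= c' -> d' <= d ->
  solves_on a b c d x v -> solves_on a b c' d' x v.
Proof.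
move=> cc dd [acx acv dx dv].
split; [exact: abs_continuousW acx|exact: abs_continuousW acv| |].
  by move=> t tcd; apply: dx; lra.
by apply: filterS dv => t H tcd; apply: H; lra.
Qed.

(** The velocity is absolutely continuous, hence bounded on [[s, T]], so [x] is Lipschitz there once
    it is known to be continuous up to the end points. *)
Lemma is_solution_solves_on a b (s T : R) x v : s < T ->
  is_solution a b s x v -> solves_on a b s T x v.
Proof.
move=> sT [[dx dxs] lacv aev].
have acv : abs_continuous s T v.
  by apply: lacv => t /=; rewrite !in_itv/= => /andP[->].
have cx t : s < t -> {for t, continuous x}.
  by move=> st; have [dxt _] := dx t st; apply/differentiable_continuous/derivable1_diffP.
have wcx : {within `[s, T], continuous x}.
  apply/continuous_within_itvP => //; split.
  - by move=> t; rewrite in_itv/= => /andP[st _]; exact: cx.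
  (* At [s] only a right derivative is given: near [s] the difference quotient is at most
     [|v s| + 1] in absolute value, which forces right continuity. *)
  - have /cvgrPdist_le/(_ 1 ltr01)[r /= r0 Hr] := dxs.
    have vs0 : 0 < `|v s| + 1 by rewrite ltr_wpDl.
    apply/cvgrPdist_lt => e e0.
    have m0 : 0 < Num.min r (e / (`|v s| + 1)) by rewrite lt_min r0 divr_gt0.
    exists (Num.min r (e / (`|v s| + 1))) => // y /=.
    rewrite lt_min distrC => /andP[yr ye] sy; have ys0 : 0 < y - s by lra.
    have := Hr (y - s); rewrite /= sub0r normrN => /(_ yr ys0).
    rewrite [s + _]addrC subrK => vq.
    have q1 : `|(y - s)^-1 * (x y - x s)| <= `|v s| + 1.
      rewrite -[X in `|X|](subKr (v s)); apply: le_trans (ler_normB _ _) _.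
      by rewrite lerD2l.
    move: q1; rewrite normrM normfV (gtr0_norm ys0) ler_pdivrMl// => q1.
    rewrite distrC; apply: le_lt_trans q1 _.
    by rewrite -ltr_pdivlMr// -(gtr0_norm ys0).
  - by apply: cvg_at_left_filter; exact: cx.
have [M vM] := within_continuous_bounded _ _ _ (ltW sT) (ac_within_continuous _ _ _ sT acv).
split => //.
- apply: (ac_derivable _ v _ _ M) => // t /andP[st _]; exact: dx.
- by move=> t /andP[st _]; exact: dx.
- apply: filterS aev => t Ht /andP[st _]; have [dv ode] := Ht (ltW st).
  by apply: DeriveDef => //; rewrite -derive1E; lra.
Qed.

(* Variation of constants: the derivative of
   [y (T - t) * v t + (y' (T - t) + a0 * y (T - t)) * x t] is
   [y (T - t) * (v' + a0 v + b0 x)] when [y] solves the autonomous equation. *)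
Lemma duhamel_increment a b (a0 b0 A B lam M sigma T : R) x v
    (y y1 g G : R -> R) : sigma < T ->
  solves_on a b sigma T x v ->
  {ae mu, forall t, sigma < t < T -> `|a t - a0| <= A /\ `|b t - b0| <= B} ->
  (forall u : R, is_derive u 1 y (y1 u)) ->
  (forall u : R, is_derive u 1 y1 (- (a0 * y1 u) - b0 * y u)) ->
  (forall u : R, 0 <= u -> `|y u| * expR (lam * u) <= g u) ->
  (forall u : R, is_derive u 1 G (g u)) -> continuous g ->
  (forall t, sigma <= t <= T ->
    expR (lam * (t - sigma)) * (A * `|v t| + B * `|x t|) <= M) ->
  `|y 0 * v T + (y1 0 + a0 * y 0) * x T -
    (y (T - sigma) * v sigma +
      (y1 (T - sigma) + a0 * y (T - sigma)) * x sigma)|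
  <= M * expR (- (lam * (T - sigma))) * (G (T - sigma) - G 0).
Proof.
move=> sT [acx acv dx dv] AB dy dy1 yg dG cg xvM.
have acr (f f' : R -> R) : (forall u : R, is_derive u 1 f (f' u)) -> continuous f' ->
    abs_continuous sigma T (fun t => f (T - t)).
  move=> df cf'; apply: (ac_C1 _ (fun t => - f' (T - t))); first exact: ltW.
    by move=> t; exact: is_derive_reflect.
  move=> t; apply: cvgN; apply: (@continuous_comp _ _ _ (fun t => T - t) f').
    by apply: cvgB; [exact: cvg_cst|exact: cvg_id].
  exact: cf'.
have cy1 : continuous y1 by exact: is_derive_continuous dy1.
have cy2 : continuous (fun u => - (a0 * y1 u) - b0 * y u).
  have cy : continuous y by exact: is_derive_continuous dy.
  move=> t; apply: cvgB; [apply: cvgN|]; apply: cvgM; try exact: cvg_cst.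
    exact: cy1.
  exact: cy.
have acy := acr _ _ dy cy1.
have acy1 := acr _ _ dy1 cy2.
have acc (k : R) : abs_continuous sigma T (fun=> k).
  by apply: (@ac_lipschitz _ _ _ _ 0) => // *; rewrite subrr normr0 mul0r.
pose K := M * expR (- (lam * (T - sigma))).
(* The majorant is [- K * G (T - t)]: reversing time flips the sign of the antiderivative [G], and
   its derivative is [K * g (T - t)]. *)
have := @ac_increment_le R
  (fun t => y (T - t) * v t + (y1 (T - t) + a0 * y (T - t)) * x t)
  (fun t => - K * G (T - t)) (fun t => K * g (T - t)) sigma T (ltW sT).
rewrite subrr.
have -> : - K * G 0 - - K * G (T - sigma) = K * (G (T - sigma) - G 0) by ring.
apply.
- apply: acD; first exact: acM.
  by apply: acM => //; apply: acD => //; exact: acM.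
- apply: acM => //; exact: acr dG cg.
- move=> t _; have := is_deriveZ_fun (- K) _ _ _ (is_derive_reflect _ _ _ _ (dG (T - t))).
  by rewrite mulrNN.
apply: filterS2 AB dv => t HAB Hv sTt.
have [At Bt] := HAB sTt; have dvt := Hv sTt; have dxt := dx _ sTt.
have dyt := is_derive_reflect _ _ _ _ (dy (T - t)).
have dy1t := is_derive_reflect _ _ _ _ (dy1 (T - t)).
(* The autonomous terms cancel, and only the perturbation of the coefficients remains. *)
exists (y (T - t) * - ((a t - a0) * v t + (b t - b0) * x t)); last first.
  apply: (is_derive_eq (is_deriveD_fun _ _ _ _ _ (is_deriveM_fun _ _ _ _ _ dyt dvt)
    (is_deriveM_fun _ _ _ _ _
      (is_deriveD_fun _ _ _ _ _ dy1t (is_deriveZ_fun a0 _ _ _ dyt)) dxt))).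
  by ring.
have Tt0 : 0 <= T - t by lra.
have yT := yg _ Tt0.
have xvt := xvM t ltac:(lra).
have xv' : `|(a t - a0) * v t + (b t - b0) * x t| <= A * `|v t| + B * `|x t|.
  by apply: le_trans (ler_normD _ _) _; apply: lerD; apply: ler_normM2.
(* The weight over [T - sigma] factors at [t]: the part over [T - t] is absorbed by [g], the part
   over [t - sigma] by the bound [M]. *)
have -> : K * g (T - t) = g (T - t) * expR (- (lam * (T - t))) *
    (expR (- (lam * (t - sigma))) * M).
  rewrite /K; have -> : - (lam * (T - sigma)) =
    - (lam * (T - t)) + - (lam * (t - sigma)) by ring.
  by rewrite expRD; ring.
apply: ler_normM2.
  by rewrite expRN ler_pdivlMr ?expR_gt0.
rewrite normrN; apply: le_trans xv' _.
by rewrite expRN ler_pdivlMl ?expR_gt0.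
Qed.

End SecondOrderEquation.

(** * Growth and decay estimates for the perturbed equation *)

Section Perturbation.
Context {R : realType}.
Implicit Types (a b x v k y : R -> R) (s t : R).
Notation mu := (@lebesgue_measure R).

(** Here [k (t - s)] is the fundamental function of [x'' + a0 x' + b0 x = 0]. It is taken on the
    whole line, so that no one-sided derivatives arise. *)
Definition autonomous_kernel (a0 b0 : R) k k1 : Prop :=
  [/\ forall u : R, is_derive u 1 k (k1 u),
      forall u : R, is_derive u 1 k1 (- (a0 * k1 u) - b0 * k u),
      k 0 = 0 & k1 0 = 1].

(* [\int_0^oo `|y u| * expR (lam * u) du <= K], witnessed by an antiderivative
   of a continuous majorant. *)
Definition weighted_L1_le (lam K : R) y : Prop :=
  exists g G : R -> R,
    [/\ continuous g, forall u : R, is_derive u 1 G (g u),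
        forall u : R, 0 <= u -> `|y u| * expR (lam * u) <= g u &
        forall u : R, 0 <= u -> G u - G 0 <= K].

Lemma weighted_L1_le_ge0 lam K y : weighted_L1_le lam K y -> 0 <= K.
Proof. by move=> [g [G [_ _ _ /(_ 0 (lexx 0))]]]; rewrite subrr. Qed.

(** The energy times [expR (- L * t)] is nonincreasing. Indeed [2 x v - 2 a v^2 - 2 b x v] is at
    most [L (x^2 + v^2)], by [2 |x v| <= x^2 + v^2], with [L = 1 + 2 Ma + Mb]. *)
Lemma energy_growth a b (Ma Mb c d : R) x v : c <= d ->
  solves_on a b c d x v ->
  {ae mu, forall t, c < t < d -> `|a t| <= Ma /\ `|b t| <= Mb} ->
  x d ^+ 2 + v d ^+ 2 <=
    expR ((1 + 2 * Ma + Mb) * (d - c)) * (x c ^+ 2 + v c ^+ 2).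
Proof.
rewrite le_eqVlt => /predU1P[-> _ _|cd [acx acv dx dv] AB].
  by rewrite subrr mulr0 expR0 mul1r.
pose L := 1 + 2 * Ma + Mb.
have ace : abs_continuous c d (fun t => expR (- L * t)).
  apply: (ac_C1 _ (fun t => - L * expR (- L * t))); first exact: ltW.
    by move=> t; exact: is_derive_expRZ.
  apply: (is_derive_continuous _ (fun t => - L * (- L * expR (- L * t)))) => t.
  by apply: is_deriveZ_fun; exact: is_derive_expRZ.
have := @ac_nonincreasing R (fun t => (x t * x t + v t * v t) * expR (- L * t)) c d (ltW cd).
rewrite !expr2 => H.
suff : (x d * x d + v d * v d) * expR (- L * d) <=
       (x c * x c + v c * v c) * expR (- L * c).
  rewrite -/L mulNr expRN ler_pdivrMr ?expR_gt0// => /le_trans; apply.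
  rewrite -mulrA -expRD mulrC; apply: ler_wpM2r.
    by rewrite addr_ge0// -expr2 sqr_ge0.
  by rewrite ler_expR; lra.
apply: H; first by apply: acM => //; apply: acD; exact: acM.
apply: filterS2 AB dv => t HAB Hv ctd.
have [At Bt] := HAB ctd; have dvt := Hv ctd; have dxt := dx _ ctd.
have := is_deriveM_fun _ _ _ _ _ (is_deriveD_fun _ _ _ _ _
  (is_deriveM_fun _ _ _ _ _ dxt dxt) (is_deriveM_fun _ _ _ _ _ dvt dvt))
  (is_derive_expRZ (- L) t).
set D := (X in is_derive _ _ _ X) => dD; exists D => //.
have -> : D = expR (- L * t) * (2 * x t * v t - 2 * a t * (v t * v t) -
    2 * b t * (x t * v t) - L * (x t * x t + v t * v t)) by rewrite /D; ring.
rewrite pmulr_rle0 ?expR_gt0//.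
have xx : 0 <= x t * x t by rewrite -expr2 sqr_ge0.
have vv : 0 <= v t * v t by rewrite -expr2 sqr_ge0.
have xv : `|x t * v t| <= (x t * x t + v t * v t) / 2.
  rewrite ler_norml; have := sqr_ge0 (x t + v t); have := sqr_ge0 (x t - v t).
  by rewrite !expr2; lra.
have Ma0 : 0 <= Ma by exact: le_trans At.
have Mb0 : 0 <= Mb by exact: le_trans Bt.
have h1 : - (a t * (v t * v t)) <= Ma * (v t * v t).
  by rewrite -mulNr ler_wpM2r//; move: At; rewrite ler_norml; lra.
have h2 := ler_normM2 _ _ _ _ Bt xv.
have h3 : - (b t * (x t * v t)) <= Mb * ((x t * x t + v t * v t) / 2).
  by apply: le_trans h2; rewrite -normrN ler_norm.
have h4 : x t * v t <= (x t * x t + v t * v t) / 2 by apply: le_trans xv; exact: ler_norm.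
have h5 : 0 <= Ma * (x t * x t) by exact: mulr_ge0.
rewrite /L; lra.
Qed.

(* The weighted maximum [M] of [A * `|v| + B * `|x|] satisfies
   [M <= C * N + (A * K1 + B * K0) * M]. *)
Lemma perturbed_decay (a0 b0 A B lam K0 K1 C : R) k k1 :
  0 <= a0 -> 0 <= b0 -> 0 <= A -> 0 <= B -> autonomous_kernel a0 b0 k k1 ->
  (forall u : R, 0 <= u -> `|k u| <= C * expR (- (lam * u))) ->
  (forall u : R, 0 <= u -> `|k1 u| <= C * expR (- (lam * u))) ->
  weighted_L1_le lam K0 k -> weighted_L1_le lam K1 k1 ->
  A * K1 + B * K0 < 1 ->
  exists2 C' : R, 0 <= C' & forall a b (sigma T : R) x v, sigma < T ->
    solves_on a b sigma T x v ->
    {ae mu, forall t, sigma < t < T -> `|a t - a0| <= A /\ `|b t - b0| <= B} ->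
    `|x T| <= C' * (`|x sigma| + `|v sigma|) * expR (- (lam * (T - sigma))).
Proof.
move=> a0_ge0 b0_ge0 A0 B0 [dk dk1 k0 k10] kC k1C kK0 k1K1 S1.
have K0_ge0 := weighted_L1_le_ge0 _ _ _ kK0.
have K1_ge0 := weighted_L1_le_ge0 _ _ _ k1K1.
have [g0 [G0 [cg0 dG0 kg0 GK0]]] := kK0.
have [g1 [G1 [cg1 dG1 kg1 GK1]]] := k1K1.
have C1 : 1 <= C.
  by have := k1C 0 (lexx 0); rewrite k10 mulr0 oppr0 expR0 normr1 mulr1.
(* Up to the exponential factor, [C1'] dominates every coefficient of the initial data in the two
   representations below: [k], [k1 + a0 k] and [- b0 k]. *)
pose C1' := C * (1 + a0 + b0).
have C0 : 0 <= C by lra.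
have C'1 : 1 <= C1'.
  have : 0 <= C * a0 by exact: mulr_ge0.
  have : 0 <= C * b0 by exact: mulr_ge0.
  by rewrite /C1'; lra.
pose S := A * K1 + B * K0; have S1' : 0 < 1 - S by rewrite /S; lra.
(* This is the bound [C1' * N + M * K0] on [x], with [M] replaced by its estimate
   [(A + B) * C1' * N / (1 - S)]. *)
exists (C1' + K0 * ((A + B) * C1' / (1 - S))).
  apply: addr_ge0; first by lra.
  by apply: mulr_ge0 => //; apply: divr_ge0; [apply: mulr_ge0; lra|exact: ltW].
move=> a b sigma T x v sT sol AB.
have [acx acv dx dv] := sol.
pose m t := expR (lam * (t - sigma)) * (A * `|v t| + B * `|x t|).
have cm : {within `[sigma, T], continuous m}.
  move=> t; apply: cvgM.
    apply: (@continuous_subspaceT _ _ `[sigma, T]%classic (fun t => expR (lam * (t - sigma)))) => {}t.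
    apply: (@continuous_comp _ _ _ (fun t => lam * (t - sigma)) expR); last exact: continuous_expR.
    by apply: cvgM; [exact: cvg_cst|apply: cvgB; [exact: cvg_id|exact: cvg_cst]].
  apply: cvgD; (apply: cvgM; first exact: cvg_cst); apply: cvg_norm.
    exact: (ac_within_continuous _ _ _ sT acv).
  exact: (ac_within_continuous _ _ _ sT acx).
have [t1 t1in Mmax] := EVT_max (ltW sT) cm.
pose M := m t1.
have M0 : 0 <= M by rewrite /M /m mulr_ge0 ?expR_ge0// addr_ge0// mulr_ge0.
pose N := `|x sigma| + `|v sigma|; have N0 : 0 <= N by rewrite addr_ge0.
have bound t : sigma <= t <= T ->
    `|x t| <= (C1' * N + M * K0) * expR (- (lam * (t - sigma))) /\
    `|v t| <= (C1' * N + M * K1) * expR (- (lam * (t - sigma))).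
  (* At [t = sigma] the bounds are immediate from [1 <= C1']; variation of constants needs a
     nondegenerate interval. *)
  move=> /andP[]; rewrite le_eqVlt => /predU1P[<- _|st tT].
    rewrite subrr mulr0 oppr0 expR0 !mulr1.
    have : N <= C1' * N by rewrite ler_peMl.
    have : 0 <= M * K0 by exact: mulr_ge0.
    have : 0 <= M * K1 by exact: mulr_ge0.
    have : `|x sigma| <= N by rewrite lerDl.
    have : `|v sigma| <= N by rewrite lerDr.
    by split; lra.
  have solt := solves_onW _ _ _ _ _ _ _ _ (lexx sigma) tT sol.
  have ABt : {ae mu, forall r, sigma < r < t -> `|a r - a0| <= A /\ `|b r - b0| <= B}.
    by apply: filterS AB => r H rt; apply: H; lra.
  have mM r : sigma <= r <= t -> m r <= M.
    by move=> rt; apply: Mmax; rewrite in_itv/=; lra.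
  have ts0 : 0 <= t - sigma by lra.
  have kt := kC _ ts0; have k1t := k1C _ ts0.
  set E := expR (- (lam * (t - sigma))) in kt k1t *.
  have E0 : 0 <= E by exact: expR_ge0.
  (* With [y = k] the initial values [k 0 = 0] and [k1 0 = 1] isolate [x t]. *)
  have H0 := duhamel_increment _ _ _ _ _ _ _ _ _ _ _ _ _ _ _ _ st solt ABt dk dk1 kg0 dG0 cg0 mM.
  have dk2 (u : R) : is_derive u 1 (fun w => - (a0 * k1 w) - b0 * k w)
      (- (a0 * (- (a0 * k1 u) - b0 * k u)) - b0 * k1 u).
    have := is_deriveD_fun _ _ _ _ _ (is_deriveZ_fun (- a0) _ _ _ (dk1 u))
      (is_deriveZ_fun (- b0) _ _ _ (dk u)).
    rewrite !mulNr; congr is_derive; apply/funext => z; by rewrite !mulNr.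
  (* With [y = k1] the coefficient [k'' + a0 k'] equals [- b0 k], which vanishes at [0], so [v t] is
     isolated. *)
  have H1 := duhamel_increment _ _ _ _ _ _ _ _ _ _ _ _ _ _ _ _ st solt ABt dk1 dk2 kg1 dG1 cg1 mM.
  rewrite -/E in H0 H1.
  have GE0 : M * E * (G0 (t - sigma) - G0 0) <= M * K0 * E.
    by rewrite mulrAC; apply: ler_wpM2r => //; apply: ler_wpM2l => //; exact: GK0.
  have GE1 : M * E * (G1 (t - sigma) - G1 0) <= M * K1 * E.
    by rewrite mulrAC; apply: ler_wpM2r => //; apply: ler_wpM2l => //; exact: GK1.
  have CE0 : 0 <= C * E by exact: mulr_ge0.
  have split_bound (p q z w P Q : R) : `|p| <= P -> `|q| <= Q ->
      P <= C1' * E -> Q <= C1' * E -> `|z - (p * v sigma + q * x sigma)| <= w ->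
      `|z| <= C1' * N * E + w.
    move=> pP qQ PC QC zw.
    have : `|p * v sigma + q * x sigma| <= C1' * N * E.
      apply: le_trans (ler_normD _ _) _; rewrite !normrM.
      have -> : C1' * N * E = C1' * E * `|v sigma| + C1' * E * `|x sigma| by rewrite /N; ring.
      by apply: lerD; apply: ler_wpM2r => //; lra.
    have := ler_normD (z - (p * v sigma + q * x sigma)) (p * v sigma + q * x sigma).
    rewrite subrK; lra.
  have a0C : 0 <= a0 * (C * E) by exact: mulr_ge0.
  have b0C : 0 <= b0 * (C * E) by exact: mulr_ge0.
  have EC : C1' * E = C * E + a0 * (C * E) + b0 * (C * E) by rewrite /C1'; ring.
  have ka : `|a0 * k (t - sigma)| <= a0 * (C * E).
    by rewrite normrM ger0_norm// ler_wpM2l.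
  have kb : `|- b0 * k (t - sigma)| <= b0 * (C * E).
    by rewrite mulNr normrN normrM ger0_norm// ler_wpM2l.
  split; rewrite mulrDl.
    move: H0; rewrite k0 k10 mul0r add0r mulr0 addr0 mul1r => H0.
    apply: le_trans (_ : C1' * N * E + M * E * (G0 (t - sigma) - G0 0) <= _); last by rewrite lerD2l.
    apply: split_bound kt _ _ _ H0; last 2 first.
    - by rewrite EC; lra.
    - exact: lexx.
    by apply: le_trans (ler_normD _ _) _; rewrite EC; lra.
  move: H1; rewrite k0 k10 mulr0 subr0 mulr1 addNr mul0r addr0 mul1r => H1.
  apply: le_trans (_ : C1' * N * E + M * E * (G1 (t - sigma) - G1 0) <= _); last by rewrite lerD2l.
  apply: split_bound k1t kb _ _ _; [by rewrite EC; lra|by rewrite EC; lra|].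
  by move: H1; congr (_ <= _); congr (`| _ |); ring.
have t1T : sigma <= t1 <= T by move: t1in; rewrite in_itv.
(* At the maximum point [t1] the two bounds give [M <= (A + B) * C1' * N + S * M], which is solved
   for [M] since [S < 1]. *)
have MN : M <= (A + B) * C1' * N / (1 - S).
  have [xt vt] := bound t1 t1T.
  rewrite ler_pdivlMr//.
  suff : M <= A * (C1' * N + M * K1) + B * (C1' * N + M * K0) by rewrite /S; lra.
  rewrite {1}/M /m -ler_pdivlMl ?expR_gt0// -expRN mulrDr; apply: lerD.
    by rewrite mulrCA; apply: ler_wpM2l => //; rewrite mulrC.
  by rewrite mulrCA; apply: ler_wpM2l => //; rewrite mulrC.
have [xT _] := bound T ltac:(by rewrite lexx ltW).
apply: le_trans xT _; apply: ler_wpM2r; first exact: expR_ge0.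
rewrite -/N mulrDl lerD2l.
have -> : K0 * ((A + B) * C1' / (1 - S)) * N = (A + B) * C1' * N / (1 - S) * K0 by ring.
exact: ler_wpM2r.
Qed.

End Perturbation.

(** * Explicit kernels of the autonomous equation and their weighted norms *)

Section AutonomousKernels.
Context {R : realType}.
Implicit Types (y k : R -> R).

Lemma is_derive_linear (w x : R) : is_derive x 1 (fun t => w * t) w.
Proof. by have := is_deriveZ_fun w _ _ _ (is_derive_id x 1); rewrite mulr1. Qed.

Lemma continuous_expRZ (c : R) : continuous (fun t : R => expR (c * t)).
Proof. exact: is_derive_continuous (is_derive_expRZ c). Qed.

Lemma weighted_L1_leW lam K K' y : K <= K' ->
  weighted_L1_le lam K y -> weighted_L1_le lam K' y.
Proof.
move=> KK [g [G [? ? ? H]]]; exists g, G; split => // u u0.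
exact: le_trans (H u u0) KK.
Qed.

(** The constant is the exact integral of the weighted majorant. A negative [c'] is allowed, for the
    difference of exponentials of two real roots; the remaining tail is nonnegative because the
    slower exponential dominates and [0 <= c + c']. *)
Lemma weighted_L1_le_expR2 lam (p q c c' : R) y : lam < p -> p <= q ->
  0 <= c -> 0 <= c + c' ->
  (forall u : R, 0 <= u -> `|y u| <= c * expR (- p * u) + c' * expR (- q * u)) ->
  weighted_L1_le lam (c / (p - lam) + c' / (q - lam)) y.
Proof.
move=> lp pq c0 cc0 yu.
have P0 : 0 < p - lam by lra.
have Q0 : 0 < q - lam by lra.
pose e (z : R) t := expR (- (z - lam) * t).
exists (fun t => c * e p t + c' * e q t).
exists (fun t => - (c / (p - lam)) * e p t + - (c' / (q - lam)) * e q t).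
split.
- by move=> t; apply: cvgD; apply: cvgM; try exact: cvg_cst; exact: continuous_expRZ.
- move=> u; apply: (is_derive_eq (is_deriveD_fun _ _ _ _ _
    (is_deriveZ_fun _ _ _ _ (is_derive_expRZ (- (p - lam)) u))
    (is_deriveZ_fun _ _ _ _ (is_derive_expRZ (- (q - lam)) u)))).
  by rewrite /e; field; rewrite !gt_eqF.
- move=> u u0; have := yu u u0 => yu'.
  have -> : c * e p u + c' * e q u =
      (c * expR (- p * u) + c' * expR (- q * u)) * expR (lam * u).
    by rewrite mulrDl -!mulrA -!expRD /e; congr (_ * expR _ + _ * expR _); ring.
  by apply: ler_wpM2r => //; exact: expR_ge0.
- move=> u u0; rewrite /e !mulr0 expR0 !mulr1.
  suff : 0 <= c / (p - lam) * e p u + c' / (q - lam) * e q u by rewrite /e; lra.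
  have : c / (q - lam) * e q u <= c / (p - lam) * e p u.
    apply: ler_pM; [by rewrite divr_ge0// ltW|exact: expR_ge0| |].
      by apply: ler_wpM2l => //; rewrite lef_pV2// ?posrE; lra.
    by rewrite ler_expR; apply: ler_wpM2r => //; lra.
  have : 0 <= (c + c') / (q - lam) * e q u.
    by apply: mulr_ge0; [rewrite divr_ge0// ltW|exact: expR_ge0].
  by lra.
Qed.

(** Integration by parts gives the constant; this majorant serves the double root. *)
Lemma weighted_L1_le_linear_expR lam (p c c' : R) y : lam < p ->
  0 <= c -> 0 <= c' ->
  (forall u : R, 0 <= u -> `|y u| <= (c + c' * u) * expR (- p * u)) ->
  weighted_L1_le lam (c / (p - lam) + c' / (p - lam) ^+ 2) y.
Proof.
move=> lp c0 c'0 yu.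
have P0 : 0 < p - lam by lra.
pose P := p - lam; pose e t := expR (- P * t).
have lin (z w u : R) : is_derive u 1 (fun t => z + w * t) w.
  have := is_deriveD_fun _ _ _ _ _ (is_derive_cst z u 1) (is_derive_linear w u).
  by rewrite add0r.
exists (fun t => (c + c' * t) * e t).
exists (fun t => (- (c / P + c' / P ^+ 2) + - (c' / P) * t) * e t).
split.
- apply: (is_derive_continuous _ (fun u => c' * e u + (c + c' * u) * (- P * e u))) => u.
  by apply: is_deriveM_fun => //; exact: is_derive_expRZ.
- move=> u; apply: (is_derive_eq (is_deriveM_fun _ _ _ _ _
    (lin _ _ u) (is_derive_expRZ (- P) u))).
  by rewrite /e; field; rewrite gt_eqF.
- move=> u u0; have yu' := yu u u0.
  have -> : (c + c' * u) * e u = (c + c' * u) * expR (- p * u) * expR (lam * u).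
    by rewrite -!mulrA -!expRD /e /P; congr (_ * expR _); ring.
  by apply: ler_wpM2r => //; exact: expR_ge0.
- move=> u u0; rewrite /e !mulr0 expR0 !mulr1 addr0 -/P.
  suff : 0 <= (c / P + c' / P ^+ 2 + c' / P * u) * expR (- P * u) by lra.
  apply: mulr_ge0; last exact: expR_ge0.
  rewrite !addr_ge0//; last (apply: mulr_ge0 => //);
    by rewrite divr_ge0// ?exprn_ge0// ltW.
Qed.

(* [c0] and [c1] bound the [L1] norms of the fundamental solution [k] and of its
   derivative [k1]; a fraction [1 - r] of the decay rate can be spent on an
   exponential weight at the price of a factor [r ^- 2]. *)
Definition kernel_rate (a0 b0 c0 c1 : R) : Prop :=
  forall r : R, 0 < r -> r < 1 -> exists lam C : R, exists k k1 : R -> R,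
    [/\ 0 < lam /\ autonomous_kernel a0 b0 k k1,
        forall u : R, 0 <= u -> `|k u| <= C * expR (- (lam * u)),
        forall u : R, 0 <= u -> `|k1 u| <= C * expR (- (lam * u)),
        weighted_L1_le lam (c0 / r ^+ 2) k &
        weighted_L1_le lam (c1 / r ^+ 2) k1].

(** The characteristic roots are [- p] and [- q], and [k] is the difference of their exponentials
    divided by [d = q - p]. It is nonnegative with integral [1 / (p q) = 1 / b0]. The triangle
    inequality bounds the norm of [k1] by [2 / d], which is at most the stated constant. *)
Lemma kernel_rate_overdamped (a0 b0 : R) : 0 < a0 -> 0 < b0 -> 4 * b0 < a0 ^+ 2 ->
  let d := Num.sqrt (a0 ^+ 2 - 4 * b0) in
  kernel_rate a0 b0 (1 / b0) (2 * a0 / (d * (a0 - d))).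
Proof.
move=> a00 b00 ab d r r0 r1.
have d2 : d ^+ 2 = a0 ^+ 2 - 4 * b0 by rewrite sqr_sqrtr//; lra.
have d0 : 0 < d by rewrite sqrtr_gt0; lra.
have da : d < a0 by rewrite -(@ltr_pXn2r _ 2%N)// ?nnegrE ?ltW// d2; lra.
pose p := (a0 - d) / 2; pose q := (a0 + d) / 2.
have p0 : 0 < p by rewrite /p; lra.
have pq : p < q by rewrite /p /q; lra.
have pqb : p * q = b0.
  have -> : p * q = (a0 ^+ 2 - d ^+ 2) / 4 by rewrite /p /q; field.
  by rewrite d2; field.
have qpd : q - p = d by rewrite /p /q; field.
have qpa : p + q = a0 by rewrite /p /q; field.
(* Then [p - lam = p * r] and [q - lam >= q * r], so each root costs one factor of [r]. *)
pose lam := p * (1 - r).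
have lam0 : 0 < lam by rewrite /lam mulr_gt0//; lra.
have pr0 : 0 < p * r by exact: mulr_gt0.
have qr0 : 0 < q * r by apply: mulr_gt0 => //; lra.
have lamp : p - lam = p * r by rewrite /lam; ring.
have lamq : q * r <= q - lam.
  have : p * (1 - r) <= q * (1 - r) by apply: ler_wpM2r; lra.
  by rewrite /lam; lra.
have elam (z u : R) : lam <= z -> 0 <= u -> expR (- z * u) <= expR (- (lam * u)).
  by move=> lz u0; rewrite ler_expR -[- (lam * u)]mulNr ler_wpM2r//; lra.
pose k u := d^-1 * expR (- p * u) + - d^-1 * expR (- q * u).
pose k1 u := - (p / d) * expR (- p * u) + q / d * expR (- q * u).
have d10 : 0 < d^-1 by rewrite invr_gt0.
have epq (u : R) : 0 <= u -> expR (- q * u) <= expR (- p * u).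
  by move=> u0; rewrite ler_expR ler_wpM2r//; lra.
have nk (u : R) : 0 <= u -> `|k u| <= d^-1 * expR (- p * u) + - d^-1 * expR (- q * u).
  by move=> u0; rewrite ger0_norm// /k; have := epq u u0; rewrite -(ler_pM2l d10); lra.
have pd0 : 0 < p / d by exact: divr_gt0.
have qd0 : 0 < q / d by apply: divr_gt0 => //; lra.
have nk1 (u : R) : 0 <= u ->
    `|k1 u| <= p / d * expR (- p * u) + q / d * expR (- q * u).
  move=> u0; apply: le_trans (ler_normD _ _) _.
  apply: lerD; rewrite normrM (ger0_norm (expR_ge0 _)); first by rewrite normrN gtr0_norm.
  by rewrite gtr0_norm.
exists lam, (d^-1 + p / d + q / d), k, k1; split.
- split => //; split.
  + move=> u; apply: (is_derive_eq (is_deriveD_fun _ _ _ _ _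
      (is_deriveZ_fun _ _ _ _ (is_derive_expRZ _ u))
      (is_deriveZ_fun _ _ _ _ (is_derive_expRZ _ u)))).
    by rewrite /k1; field; rewrite gt_eqF.
  + move=> u; apply: (is_derive_eq (is_deriveD_fun _ _ _ _ _
      (is_deriveZ_fun _ _ _ _ (is_derive_expRZ _ u))
      (is_deriveZ_fun _ _ _ _ (is_derive_expRZ _ u)))).
    by rewrite /k1 /k -pqb -qpa; field; rewrite gt_eqF.
  + by rewrite /k !mulr0 expR0; ring.
  + by rewrite /k1 !mulr0 expR0 -qpd; field; rewrite subr_eq0 gt_eqF.
- move=> u u0; apply: le_trans (nk u u0) _.
  have := elam p u ltac:(lra) u0; rewrite -(ler_pM2l d10).
  have : 0 <= d^-1 * expR (- q * u) by rewrite mulr_ge0 ?expR_ge0// ltW.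
  have : 0 <= (p / d + q / d) * expR (- (lam * u)) by rewrite mulr_ge0 ?expR_ge0//; lra.
  by lra.
- move=> u u0; apply: le_trans (nk1 u u0) _.
  have := elam p u ltac:(lra) u0; rewrite -(ler_pM2l pd0) => hp.
  have := elam q u ltac:(lra) u0; rewrite -(ler_pM2l qd0) => hq.
  have : 0 <= d^-1 * expR (- (lam * u)) by rewrite mulr_ge0 ?expR_ge0// ltW.
  by lra.
- apply: weighted_L1_leW (weighted_L1_le_expR2 lam p q d^-1 (- d^-1) k _ _ _ _ nk); try lra.
  have -> : d^-1 / (p - lam) + - d^-1 / (q - lam) = ((p - lam) * (q - lam))^-1.
    by rewrite -qpd; field; rewrite !gt_eqF//; lra.
  have -> : 1 / b0 / r ^+ 2 = ((p * r) * (q * r))^-1.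
    by rewrite -pqb; field; rewrite !gt_eqF//; lra.
  rewrite lef_pV2 ?posrE ?mulr_gt0//; try lra.
  by rewrite lamp ler_pM2l.
- apply: weighted_L1_leW (weighted_L1_le_expR2 lam p q (p / d) (q / d) k1 _ _ _ _ nk1); try lra.
  apply: (@le_trans _ _ (p / d / (p * r) + q / d / (q * r))).
    rewrite lamp lerD2l; apply: ler_wpM2l; first exact: ltW.
    by rewrite lef_pV2 ?posrE//; lra.
  have -> : p / d / (p * r) + q / d / (q * r) = 2 / d * r * (r ^+ 2)^-1.
    by field; rewrite !gt_eqF//; lra.
  rewrite ler_pM2r ?invr_gt0 ?exprn_gt0//.
  (* The comparison reduces to [r <= 1 <= a0 / (a0 - d)]. *)
  have -> : 2 * a0 / (d * (a0 - d)) = 2 / d * (a0 / (a0 - d)).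
    by field; rewrite !gt_eqF//; lra.
  apply: ler_wpM2l; first by rewrite divr_ge0// ltW.
  apply: (@le_trans _ _ 1); first exact: ltW.
  by rewrite ler_pdivlMr; lra.
Qed.

(** The roots are [- p] plus or minus [i w], and sine and cosine are bounded by [1]. The integrals
    of the resulting majorants are [1 / (w p)] and [1 / p + 1 / w], the two stated constants. *)
Lemma kernel_rate_underdamped (a0 b0 : R) : 0 < a0 -> 0 < b0 -> a0 ^+ 2 < 4 * b0 ->
  let d := Num.sqrt (4 * b0 - a0 ^+ 2) in
  kernel_rate a0 b0 (4 / (a0 * d)) (2 * (a0 + d) / (a0 * d)).
Proof.
move=> a00 b00 ab d r r0 r1.
have d2 : d ^+ 2 = 4 * b0 - a0 ^+ 2 by rewrite sqr_sqrtr//; lra.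
have d0 : 0 < d by rewrite sqrtr_gt0; lra.
pose p := a0 / 2; pose w := d / 2.
have p0 : 0 < p by rewrite /p; lra.
have w0 : 0 < w by rewrite /w; lra.
have pa : a0 = 2 * p by rewrite /p; field.
have wd : d = 2 * w by rewrite /w; field.
have wpb : b0 = w ^+ 2 + p ^+ 2 by rewrite /w /p !expr_div_n d2; field.
pose lam := p * (1 - r).
have lam0 : 0 < lam by rewrite /lam mulr_gt0//; lra.
have pr0 : 0 < p * r by exact: mulr_gt0.
have lamp : p - lam = p * r by rewrite /lam; ring.
have pw0 : 0 < p / w by exact: divr_gt0.
have w10 : 0 < w^-1 by rewrite invr_gt0.
have sn (u : R) : `|sin u| <= 1 by rewrite ler_norml sin_geN1 sin_le1.
have cn (u : R) : `|cos u| <= 1 by rewrite ler_norml cos_geN1 cos_le1.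
pose k u := w^-1 * sin (w * u) * expR (- p * u).
pose k1 u := (cos (w * u) + - (p / w) * sin (w * u)) * expR (- p * u).
have nk u : `|k u| <= w^-1 * expR (- p * u).
  rewrite /k !normrM (ger0_norm (expR_ge0 _)) (gtr0_norm w10).
  by apply: ler_wpM2r; [exact: expR_ge0|rewrite ler_piMr// ltW].
have nk1 u : `|k1 u| <= (1 + p / w) * expR (- p * u).
  rewrite /k1 normrM (ger0_norm (expR_ge0 _)).
  apply: ler_wpM2r; first exact: expR_ge0.
  apply: le_trans (ler_normD _ _) _; apply: lerD => //.
  by rewrite normrM normrN (gtr0_norm pw0) ler_piMr// ltW.
have dsin (u : R) : is_derive u 1 (fun t => sin (w * t)) (cos (w * u) * w).
  exact: (@is_derive1_comp R sin (fun t => w * t)) (is_derive_linear w u).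
have dcos (u : R) : is_derive u 1 (fun t => cos (w * t)) (- sin (w * u) * w).
  exact: (@is_derive1_comp R cos (fun t => w * t)) (is_derive_linear w u).
have elam (u : R) : 0 <= u -> expR (- p * u) <= expR (- (lam * u)).
  by move=> u0; rewrite ler_expR -[- (lam * u)]mulNr ler_wpM2r//; lra.
exists lam, (w^-1 + (1 + p / w)), k, k1; split.
- split => //; split.
  + move=> u; apply: (is_derive_eq (is_deriveM_fun _ _ _ _ _
      (is_deriveZ_fun _ _ _ _ (dsin u)) (is_derive_expRZ _ u))).
    by rewrite /k1; field; rewrite gt_eqF.
  + move=> u; apply: (is_derive_eq (is_deriveM_fun _ _ _ _ _
      (is_deriveD_fun _ _ _ _ _ (dcos u) (is_deriveZ_fun _ _ _ _ (dsin u)))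
      (is_derive_expRZ _ u))).
    by rewrite /k1 /k wpb pa; field; rewrite gt_eqF.
  + by rewrite /k mulr0 sin0 mulr0 mul0r.
  + by rewrite /k1 !mulr0 sin0 cos0 expR0 mulr0 addr0 mulr1.
- move=> u u0; apply: le_trans (nk u) _.
  apply: ler_pM; [exact: ltW|exact: expR_ge0|lra|exact: elam].
- move=> u u0; apply: le_trans (nk1 u) _.
  apply: ler_pM; [lra|exact: expR_ge0|lra|exact: elam].
- have nk' (u : R) : 0 <= u -> `|k u| <= w^-1 * expR (- p * u) + 0 * expR (- p * u).
    by rewrite mul0r addr0.
  apply: weighted_L1_leW (weighted_L1_le_expR2 lam p p w^-1 0 k _ _ _ _ nk'); try lra.
  rewrite mul0r addr0 lamp.
  have -> : w^-1 / (p * r) = 4 / (a0 * d) * r / r ^+ 2.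
    by rewrite pa wd; field; rewrite !gt_eqF//; lra.
  rewrite ler_pM2r ?invr_gt0 ?exprn_gt0// ler_piMr ?ltW//.
  by rewrite divr_gt0// mulr_gt0.
- have nk' (u : R) : 0 <= u -> `|k1 u| <= (1 + p / w) * expR (- p * u) + 0 * expR (- p * u).
    by rewrite mul0r addr0.
  apply: weighted_L1_leW (weighted_L1_le_expR2 lam p p (1 + p / w) 0 k1 _ _ _ _ nk'); try lra.
  rewrite mul0r addr0 lamp.
  have -> : (1 + p / w) / (p * r) = 2 * (a0 + d) / (a0 * d) * r / r ^+ 2.
    by rewrite pa wd; field; rewrite !gt_eqF//; lra.
  rewrite ler_pM2r ?invr_gt0 ?exprn_gt0// ler_piMr ?ltW//.
  by rewrite divr_gt0 ?mulr_gt0//; lra.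
Qed.

(** The double root [- p], with [p = Num.sqrt b0], gives [k u = u * expR (- p * u)]. The majorants
    of [k] and [k1] integrate to [1 / p^2] and [1 / p + p / p^2 = 2 / p]. *)
Lemma kernel_rate_critical (a0 b0 : R) : 0 < a0 -> 0 < b0 -> a0 ^+ 2 = 4 * b0 ->
  kernel_rate a0 b0 (1 / b0) (2 / Num.sqrt b0).
Proof.
move=> a00 b00 ab r r0 r1.
pose p := a0 / 2.
have p0 : 0 < p by rewrite /p; lra.
have pa : a0 = 2 * p by rewrite /p; field.
have pb : b0 = p ^+ 2 by rewrite /p expr_div_n ab; field.
have -> : Num.sqrt b0 = p by rewrite pb sqrtr_sqr gtr0_norm.
pose lam := p * (1 - r).
have lam0 : 0 < lam by rewrite /lam mulr_gt0//; lra.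
have pr0 : 0 < p * r by exact: mulr_gt0.
have lamp : p - lam = p * r by rewrite /lam; ring.
pose k u := u * expR (- p * u).
pose k1 u := (1 + - p * u) * expR (- p * u).
have nk (u : R) : 0 <= u -> `|k u| <= (0 + 1 * u) * expR (- p * u).
  by move=> u0; rewrite add0r mul1r ger0_norm// mulr_ge0 ?expR_ge0.
have nk1 (u : R) : 0 <= u -> `|k1 u| <= (1 + p * u) * expR (- p * u).
  move=> u0; rewrite /k1 normrM (ger0_norm (expR_ge0 _)).
  apply: ler_wpM2r; first exact: expR_ge0.
  apply: le_trans (ler_normD _ _) _.
  by rewrite normr1 normrM normrN (gtr0_norm p0) (ger0_norm u0).
(* The linear factor is absorbed by the spare rate [p * r], through [1 + z <= expR z] at
   [z = p * r * u]. *)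
have uexp (u : R) : 0 <= u -> u * expR (- p * u) <= (p * r)^-1 * expR (- (lam * u)).
  move=> u0; have -> : - p * u = - (p * r * u) + - (lam * u) by rewrite /lam; ring.
  rewrite expRD mulrA; apply: ler_wpM2r; first exact: expR_ge0.
  rewrite expRN ler_pdivrMr ?expR_gt0// ler_pdivlMl//.
  by apply: le_trans (expR_ge1Dx _); lra.
have elam (u : R) : 0 <= u -> expR (- p * u) <= expR (- (lam * u)).
  by move=> u0; rewrite ler_expR -[- (lam * u)]mulNr ler_wpM2r//; lra.
have did (u : R) : is_derive u 1 (fun t : R => t) (1 : R) by exact: is_derive_id.
have dlin (u : R) : is_derive u 1 (fun t => 1 + - p * t) (- p).
  have := is_deriveD_fun _ _ _ _ _ (is_derive_cst (1 : R) u 1) (is_derive_linear (- p) u).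
  by rewrite add0r.
exists lam, ((p * r)^-1 + 1 + p * (p * r)^-1), k, k1; split.
- split => //; split.
  + move=> u; apply: (is_derive_eq (is_deriveM_fun _ _ _ _ _ (did u) (is_derive_expRZ _ u))).
    by rewrite /k1; ring.
  + move=> u; apply: (is_derive_eq (is_deriveM_fun _ _ _ _ _ (dlin u) (is_derive_expRZ _ u))).
    by rewrite /k1 /k pb pa; ring.
  + by rewrite /k mul0r.
  + by rewrite /k1 !mulr0 expR0 addr0 mulr1.
- move=> u u0; apply: le_trans (nk u u0) _; rewrite add0r mul1r.
  apply: le_trans (uexp u u0) _; apply: ler_wpM2r; first exact: expR_ge0.
  by rewrite -addrA lerDl addr_ge0// mulr_ge0 ?invr_ge0// ltW.
- move=> u u0; apply: le_trans (nk1 u u0) _.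
  have := uexp u u0; rewrite -(ler_pM2l p0); have := elam u u0.
  have : 0 <= (p * r)^-1 * expR (- (lam * u)) by rewrite mulr_ge0 ?expR_ge0// invr_ge0 ltW.
  by lra.
- apply: weighted_L1_leW (weighted_L1_le_linear_expR lam p 0 1 k _ _ _ nk); try lra.
  rewrite mul0r add0r lamp pb.
  by rewrite le_eqVlt; apply/orP; left; apply/eqP; field; rewrite !gt_eqF.
- apply: weighted_L1_leW (weighted_L1_le_linear_expR lam p 1 p k1 _ _ _ nk1); try lra.
  rewrite lamp.
  have -> : 1 / (p * r) + p / (p * r) ^+ 2 = (1 + r) / p / r ^+ 2.
    by field; rewrite !gt_eqF.
  by rewrite !ler_pM2r ?invr_gt0 ?exprn_gt0//; lra.
Qed.

End AutonomousKernels.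

(** * From essential norms to exponential stability *)

Section EssentialBounds.
Context {R : realType}.
Notation mu := (@lebesgue_measure R).
Notation halfline t0 := (measurable_itv (Interval (BLeft t0) (BInfty R false))).

(** At exponent [+oo], [Lnorm] is the essential supremum under the condition that the whole space
    has positive measure. *)
Lemma lebesgue_measure_halfline_gt0 (t0 : R) :
  (0 < mrestr mu (halfline t0) [set: R])%E.
Proof.
rewrite /mrestr setTI.
by have := lebesgue_measure_itv `[t0, +oo[; rewrite /= ltry => ->; rewrite addye ?ltry.
Qed.

Lemma Linfty_norm_ge0 (t0 : R) (f : R -> R) : (0 <= Linfty_norm t0 f)%E.
Proof. exact: Lnorm_ge0. Qed.

Lemma Linfty_norm_ae (t0 A : R) (f : R -> R) : Linfty_norm t0 f = A%:E ->
  {ae mu, forall t, t0 <= t -> `|f t| <= A}.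
Proof.
rewrite /Linfty_norm unlock lebesgue_measure_halfline_gt0 => essA.
have := ess_sup_ge (mrestr mu (halfline t0)) (abse \o (EFin \o f)).
rewrite essA => -[N [mN N0 subN]].
(* A null set of the restricted measure becomes Lebesgue null after intersection with the
   half-line. *)
exists (N `&` `[t0, +oo[); split => //; first exact: measurableI.
move=> t /= /not_implyP[t0t ftA]; split; last by rewrite /= in_itv/= t0t.
by apply: subN => /=; rewrite lee_fin.
Qed.

Lemma mule_fin_lty (x : \bar R) (c : R) : (0 <= x)%E -> 0 < c ->
  (x * c%:E < +oo)%E -> exists2 A : R, 0 <= A & x = A%:E.
Proof.
case: x => [A| |] // x0 c0; first by exists A.
by rewrite gt0_mulye ?lte_fin// ltxx.
Qed.

(** The norms are extended reals; positive coefficients and a sum below [1] force both to be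
    finite. *)
Lemma Linfty_norm_pair (t0 c0 c1 : R) (f g : R -> R) : 0 < c0 -> 0 < c1 ->
  (Linfty_norm t0 f * c1%:E + Linfty_norm t0 g * c0%:E < 1)%E ->
  exists A B : R, [/\ 0 <= A, 0 <= B, A * c1 + B * c0 < 1,
    {ae mu, forall t, t0 <= t -> `|f t| <= A} &
    {ae mu, forall t, t0 <= t -> `|g t| <= B}].
Proof.
move=> c00 c10 fg1.
have f0 : (0 <= Linfty_norm t0 f * c1%:E)%E by rewrite mule_ge0 ?Linfty_norm_ge0 ?lee_fin ?ltW.
have g0 : (0 <= Linfty_norm t0 g * c0%:E)%E by rewrite mule_ge0 ?Linfty_norm_ge0 ?lee_fin ?ltW.
have [|A A0 fA] := mule_fin_lty _ _ (Linfty_norm_ge0 t0 f) c10.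
  by apply: le_lt_trans (lt_trans fg1 (ltry _)); exact: leeDl.
have [|B B0 gB] := mule_fin_lty _ _ (Linfty_norm_ge0 t0 g) c00.
  by apply: le_lt_trans (lt_trans fg1 (ltry _)); exact: leeDr.
exists A, B; split => //; [|exact: Linfty_norm_ae|exact: Linfty_norm_ae].
by rewrite -lte_fin EFinD !EFinM -fA -gB.
Qed.

Lemma kernel_rate_exponentially_stable (a b : R -> R) (a0 b0 t0 c0 c1 : R) :
  0 <= a0 -> 0 <= b0 -> 0 <= t0 -> 0 < c0 -> 0 < c1 ->
  ess_bounded [set` `[0%R, +oo[] a -> ess_bounded [set` `[0%R, +oo[] b ->
  kernel_rate a0 b0 c0 c1 ->
  (Linfty_norm t0 (fun t => a t - a0)%R * c1%:E +
   Linfty_norm t0 (fun t => b t - b0)%R * c0%:E < 1)%E ->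
  exponentially_stable a b.
Proof.
move=> a0_ge0 b0_ge0 t0_ge0 c00 c10 [Ma aMa] [Mb bMb] rate.
move=> /(Linfty_norm_pair _ _ _ _ _ c00 c10)[A [B [A0 B0 S1 aA bB]]].
(* This [r] satisfies [S < r^2 < 1], since [(1 + S)^2 - 4 S = (1 - S)^2 > 0]; hence [S / r^2 < 1],
   which leaves room for the weight. *)
pose S := A * c1 + B * c0; pose r := (1 + S) / 2.
have S0 : 0 <= S by rewrite addr_ge0// mulr_ge0// ltW.
have [r0 r1] : 0 < r /\ r < 1 by rewrite /r /S in S0 *; split; lra.
have Sr : A * (c1 / r ^+ 2) + B * (c0 / r ^+ 2) < 1.
  rewrite !mulrA -mulrDl ltr_pdivrMr ?exprn_gt0// mul1r -/S /r expr_div_n.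
  rewrite ltr_pdivlMr ?exprn_gt0//.
  have : 0 < (1 - S) ^+ 2 by rewrite exprn_gt0// /S; lra.
  by rewrite !expr2; lra.
have [lam [C [k [k1 [[lam0 ker] kC k1C kK k1K]]]]] := rate r r0 r1.
have [C' C'0 decay] := perturbed_decay _ _ _ _ _ _ _ _ _ _
  a0_ge0 b0_ge0 A0 B0 ker kC k1C kK k1K Sr.
move=> X fundX.
(* [E0] bounds the energy growth over any time at most [t0]; the absolute value makes the exponent
   monotone in the elapsed time. *)
pose L := `|1 + 2 * Ma + Mb|; pose E0 := expR (L * t0).
have E01 : 1 <= E0 by rewrite /E0 -(@expR0 R) ler_expR mulr_ge0 ?normr_ge0.
(* The [1] serves [t <= t0], and [2 * C'] the decay from [sigma], where [|x| + |v| <= 2 * E0]. The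
   factor [expR (lam * t0)] pays for the time up to [t0] without decay. *)
exists ((1 + 2 * C') * E0 * expR (lam * t0)), lam; split => //.
  by rewrite !mulr_gt0 ?expR_gt0//; lra.
move=> t s s0 st.
have [v [sol Xss vs]] := fundX s s0.
pose x t := X t s.
have K0 (u : R) : u <= lam * t0 -> 1 <= expR (lam * t0 - u).
  by move=> ?; rewrite -(@expR0 R) ler_expR; lra.
have [<-|sneqt] := eqVneq s t.
  by rewrite Xss normr0 !mulr_ge0 ?expR_ge0//; lra.
have {st sneqt} st : s < t by rewrite lt_neqAle sneqt.
have sol_st := is_solution_solves_on _ _ _ _ _ _ st sol.
have initial u : s <= u -> u <= t -> (u <= t0 \/ u = s) ->
    `|x u| <= E0 /\ `|v u| <= E0.
  move=> su ut ut0.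
  have sol_su := solves_onW _ _ _ _ _ _ _ _ (lexx s) ut sol_st.
  have := energy_growth _ _ Ma Mb _ _ _ _ su sol_su.
  have aeM : {ae mu, forall r, s < r < u -> `|a r| <= Ma /\ `|b r| <= Mb}.
    apply: filterS2 aMa bMb => z Ha Hb zsu.
    by split; [apply: Ha|apply: Hb]; rewrite /= in_itv/= andbT; lra.
  move=> /(_ aeM); rewrite /= Xss vs expr0n/= add0r expr1n mulr1 -/(x u) => EE.
  have EE0 : expR ((1 + 2 * Ma + Mb) * (u - s)) <= E0.
    rewrite ler_expR; apply: le_trans (_ : L * (u - s) <= _).
      by apply: ler_wpM2r; [lra|exact: ler_norm].
    by apply: ler_wpM2l; [exact: normr_ge0|case: ut0 => ?; lra].
  (* Since [1 <= E0], a square below [E0] is below [E0 ^+ 2]. *)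
  have sq (z : R) : z ^+ 2 <= E0 -> `|z| <= E0.
    move=> zE; rewrite -(@ler_pXn2r _ 2%N)// ?nnegrE//; last by lra.
    rewrite real_normK ?num_real//; apply: le_trans zE _.
    by rewrite expr2 ler_peMl//; lra.
  have := sqr_ge0 (x u); have := sqr_ge0 (v u) => v2 x2.
  by split; apply: sq; lra.
have [tt0|t0t] := leP t t0.
  have [xt _] := initial t (ltW st) (lexx t) (or_introl tt0).
  rewrite -mulrA -expRD.
  have e1 := K0 (lam * (t - s)) ltac:(by rewrite ler_pM2l//; lra).
  apply: le_trans xt _; apply: (@le_trans _ _ ((1 + 2 * C') * E0)).
    by rewrite ler_peMl; lra.
  by rewrite ler_peMr// mulr_ge0; lra.
(* From [sigma] on, both the solution and the coefficient bounds are available, and at most [t0] has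
   elapsed since [s]. *)
pose sigma := Num.max s t0.
have ssigma : s <= sigma by rewrite le_max lexx.
have t0sigma : t0 <= sigma by rewrite le_max lexx orbT.
have sigmat : sigma < t by rewrite gt_max st.
have sigma_t0 : sigma - s <= t0 by rewrite /sigma; case: (leP s t0); lra.
have [xs vs'] : `|x sigma| <= E0 /\ `|v sigma| <= E0.
  apply: initial => //; first exact: ltW.
  by rewrite /sigma; case: (leP s t0); [left|right].
have := decay a b sigma t x v sigmat (solves_onW _ _ _ _ _ _ _ _ ssigma (lexx t) sol_st).
have aeAB : {ae mu, forall r, sigma < r < t -> `|a r - a0| <= A /\ `|b r - b0| <= B}.
  by apply: filterS2 aA bB => z Ha Hb zst; split; [apply: Ha|apply: Hb]; lra.
move=> /(_ aeAB) xt; apply: le_trans xt _.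
rewrite -[leRHS]mulrA -expRD; apply: ler_pM.
- by rewrite mulr_ge0// addr_ge0.
- exact: expR_ge0.
- have : C' * (`|x sigma| + `|v sigma|) <= C' * (2 * E0) by apply: ler_wpM2l => //; lra.
  by lra.
- rewrite ler_expR.
  have : lam * (sigma - s) <= lam * t0 by rewrite ler_pM2l.
  by lra.
Qed.

End EssentialBounds.

Theorem theorem9 (R : realType) (a b : R -> R) (alpha a0 b0 t0 : R)
  (a_meas : lebesgue_measurable_fun [set` `[0%R, +oo[] a)
  (b_meas : lebesgue_measurable_fun [set` `[0%R, +oo[] b)
  (a_bnd : ess_bounded [set` `[0%R, +oo[] a)
  (b_bnd : ess_bounded [set` `[0%R, +oo[] b)
  (alpha_gt0 : 0 < alpha)
  (a_ge : {ae lebesgue_measure, forall t : R, 0 <= t -> alpha <= a t})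
  (b_ge : {ae lebesgue_measure, forall t : R, 0 <= t -> 0 <= b t})
  (a0_gt0 : 0 < a0) (b0_gt0 : 0 < b0) (t0_ge0 : 0 <= t0)
  (cond :
    [\/ (4 * b0 < a0 ^+ 2) /\
        (Linfty_norm t0 (fun t => a t - a0)%R *
           (2 * a0 / (Num.sqrt (a0 ^+ 2 - 4 * b0) *
                      (a0 - Num.sqrt (a0 ^+ 2 - 4 * b0))))%R%:E
         + Linfty_norm t0 (fun t => b t - b0)%R * (1 / b0)%R%:E < 1)%E,
        (a0 ^+ 2 < 4 * b0) /\
        (Linfty_norm t0 (fun t => a t - a0)%R *
           (2 * (a0 + Num.sqrt (4 * b0 - a0 ^+ 2)) /
              (a0 * Num.sqrt (4 * b0 - a0 ^+ 2)))%R%:E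
         + Linfty_norm t0 (fun t => b t - b0)%R *
           (4 / (a0 * Num.sqrt (4 * b0 - a0 ^+ 2)))%R%:E < 1)%E |
        (a0 ^+ 2 = 4 * b0) /\
        (Linfty_norm t0 (fun t => a t - a0)%R * (2 / Num.sqrt b0)%R%:E
         + Linfty_norm t0 (fun t => b t - b0)%R * (1 / b0)%R%:E < 1)%E]) :
  exponentially_stable a b.
Proof.
have a2 : 0 < a0 ^+ 2 by rewrite exprn_gt0.
(* The sign of [a0 ^+ 2 - 4 * b0] selects the kernel; it remains to check that both coefficients are
   positive. *)
case: cond => [[ab lt1]|[ab lt1]|[ab lt1]].
- have d0 : 0 < Num.sqrt (a0 ^+ 2 - 4 * b0) by rewrite sqrtr_gt0; lra.
  have da : Num.sqrt (a0 ^+ 2 - 4 * b0) < a0.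
    by rewrite -(@ltr_pXn2r _ 2%N)// ?nnegrE ?ltW// sqr_sqrtr; lra.
  apply: (kernel_rate_exponentially_stable _ _ _ _ _ _ _ (ltW a0_gt0)
    (ltW b0_gt0) t0_ge0 _ _ a_bnd b_bnd
    (kernel_rate_overdamped _ _ a0_gt0 b0_gt0 ab) lt1).
    by rewrite divr_gt0.
  by rewrite divr_gt0 ?mulr_gt0//; lra.
- have d0 : 0 < Num.sqrt (4 * b0 - a0 ^+ 2) by rewrite sqrtr_gt0; lra.
  apply: (kernel_rate_exponentially_stable _ _ _ _ _ _ _ (ltW a0_gt0)
    (ltW b0_gt0) t0_ge0 _ _ a_bnd b_bnd
    (kernel_rate_underdamped _ _ a0_gt0 b0_gt0 ab) lt1).
    by rewrite divr_gt0 ?mulr_gt0.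
  by rewrite divr_gt0 ?mulr_gt0//; lra.
- apply: (kernel_rate_exponentially_stable _ _ _ _ _ _ _ (ltW a0_gt0)
    (ltW b0_gt0) t0_ge0 _ _ a_bnd b_bnd
    (kernel_rate_critical _ _ a0_gt0 b0_gt0 ab) lt1).
    by rewrite divr_gt0.
  by rewrite divr_gt0 ?sqrtr_gt0.
Qed.
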